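(* Let $\mathcal{S}_1\subseteq\mathcal{S}_2\subseteq\cdots$ be a nested sequence of compact groups of orthonormal $n\times n$ matrices, and let $\iota\in\mathbb{R}^n$ be a unit vector. Suppose that $p=1$, so that the observation $X$ is a random vector in $\mathbb{R}^n$, and that we want to test the null hypothesis that $X$ is $\mathcal{S}_k$ invariant against the alternative hypothesis that $X\sim\mathcal{N}(\iota\mu,\sigma^2 I_n)$, $\mu,\sigma>0$. Then, for $i\le j\le k$, the $\mathcal{S}_j$ invariance test with test statistic $\iota'X$ is at least as powerful as the $\mathcal{S}_i$ invariance test with test statistic $\iota'X$ (both at the same level $\alpha$). That is, the power is monotonically increasing in the number of elements of the subgroup.
   Context: A prime denotes transposition, $I_n$ is the $n\times n$ identity matrix, and $p$ denotes the number of hypotheses (columns of the data). For a compact group $\mathcal{S}$ of orthonormal $n\times n$ matrices, a random vector $X$ in $\mathbb{R}^n$ is $\mathcal{S}$ invariant if $X\overset{d}{=}SX$ for all $S\in\mathcal{S}$. The $\mathcal{S}$ invariance test at level $\alpha$ with test statistic $T(x)=\iota'x$: let $\overline{S}$ be uniformly (Haar) distributed on $\mathcal{S}$. For an observed realization $x$ of $X$, the reference distribution is the distribution of $T(\overline{S}x)$ with $x$ held fixed. The test rejects if $T(x)$ exceeds the critical value given by the $\alpha$ upper-quantile of this reference distribution. Such a test is exact up to discreteness of the reference distribution. The power of a test is its probability of rejection under the alternative.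
   Formalization: As discreteness makes the literal claim fail, power monotonicity is proved for tests randomized at the critical value to have exact level α, and for the non-randomized tests when, a.s. under the alternative, the S_j test's attained level is at least the S_i test's. *)

(* Defs.v *)
(* MathComp-Analysis, over an arbitrary realType. *)
From HB Require Import structures.
From mathcomp Require Import all_boot all_order all_algebra.
From mathcomp Require Import all_classical all_reals all_analysis.
Import Order.TTheory GRing.Theory Num.Theory.
Import numFieldNormedType.Exports.

Set Implicit Arguments.
Unset Strict Implicit.
Unset Printing Implicit Defensive.

Local Open Scope classical_set_scope.
Local Open Scope ring_scope.

Notation borel T := (g_sigma_algebraType (@open T)).

Definition compact_orthogonal_group (R : realType) (n : nat)
    (S : set 'M[R]_n) : Prop :=
  [/\ compact S,
      (forall U, S U -> U^T *m U = 1%:M),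
      S 1%:M,
      (forall U V, S U -> S V -> S (U *m V)) &
      (forall U, S U -> S (invmx U))].

(* [H] is the law of a matrix uniformly distributed on [S], i.e. the Haar
   probability of [S]; on a compact group it is invariant on both sides. *)
Definition haar (R : realType) (n : nat) (S : set 'M[R]_n)
    (H : probability (borel 'M[R]_n) R) : Prop :=
  [/\ H S = 1%E,
      (forall U (A : set (borel 'M[R]_n)), S U -> measurable A ->
         H [set V : 'M[R]_n | A (U *m V)] = H A) &
      (forall U (A : set (borel 'M[R]_n)), S U -> measurable A ->
         H [set V : 'M[R]_n | A (V *m U)] = H A)].

Definition invariant_under (R : realType) (n : nat) (S : set 'M[R]_n)
    (d : measure_display) (T : measurableType d) (P : probability T R)
    (X : {RV P >-> borel 'cV[R]_n}) : Prop :=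
  forall U, S U -> forall A : set (borel 'cV[R]_n), measurable A ->
    P [set w | A (X w)] = P [set w | A (U *m (X w : 'cV[R]_n))].

(* N(m, sigma^2 I_n) is the product of the laws N(m_i, sigma^2); the second
   parameter of [normal_prob] is the standard deviation. *)
Definition normal_vector (R : realType) (n : nat) (m : 'cV[R]_n) (sigma : R)
    (d : measure_display) (T : measurableType d) (P : probability T R)
    (X : {RV P >-> borel 'cV[R]_n}) : Prop :=
  forall A : 'I_n -> set R, (forall i, measurable (A i)) ->
    P [set w | forall i, A i ((X w : 'cV[R]_n) i ord0)] =
    (\prod_(i < n) normal_prob (m i ord0) sigma (A i))%E.

Definition stat (R : realType) (n : nat) (iota x : 'cV[R]_n) : R :=
  (iota^T *m x) ord0 ord0.

Definition ref_gt (R : realType) (n : nat)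
    (H : probability (borel 'M[R]_n) R) (iota x : 'cV[R]_n) (c : R) : R :=
  fine (H [set U : 'M[R]_n | c < stat iota (U *m x)]).

Definition ref_eq (R : realType) (n : nat)
    (H : probability (borel 'M[R]_n) R) (iota x : 'cV[R]_n) (c : R) : R :=
  fine (H [set U : 'M[R]_n | stat iota (U *m x) = c]).

(* The [alpha] upper-quantile of the reference distribution at [x]. *)
Definition critical_value (R : realType) (n : nat)
    (H : probability (borel 'M[R]_n) R) (iota : 'cV[R]_n) (alpha : R)
    (x : 'cV[R]_n) : R :=
  inf [set c | ref_gt H iota x c <= alpha].

Definition rejection_region (R : realType) (n : nat)
    (H : probability (borel 'M[R]_n) R) (iota : 'cV[R]_n) (alpha : R) :
    set 'cV[R]_n :=
  [set x | critical_value H iota alpha x < stat iota x].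

(* The mass of the reference distribution beyond its critical value: at most
   [alpha], and smaller than [alpha] only because of atoms (discreteness). *)
Definition attained_level (R : realType) (n : nat)
    (H : probability (borel 'M[R]_n) R) (iota : 'cV[R]_n) (alpha : R)
    (x : 'cV[R]_n) : R :=
  ref_gt H iota x (critical_value H iota alpha x).

(* Conditional rejection probability of the test made exact at level [alpha]:
   it rejects on [rejection_region] and randomizes when the statistic equals
   the critical value.  If the critical value is not an atom, then
   [attained_level] is [alpha] and the randomization probability is 0 / 0,
   that is 0. *)
Definition exact_test (R : realType) (n : nat)
    (H : probability (borel 'M[R]_n) R) (iota : 'cV[R]_n) (alpha : R)
    (x : 'cV[R]_n) : R :=
  let c := critical_value H iota alpha x in
  if c < stat iota x then 1
  else if stat iota x == c then
    (alpha - attained_level H iota alpha x) / ref_eq H iota x c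
  else 0.

(* Main.v *)
Require Import Defs.
From HB Require Import structures.
From mathcomp Require Import all_boot all_order all_algebra.
From mathcomp Require Import all_classical all_reals all_analysis.
From mathcomp Require Import measurable_realfun ring lra.

(** Why a larger group gives a more powerful test.

    Fix a group [S] with Haar law [H].  On each orbit [S x] the critical value
    is constant, so the exact test rejects for the largest values of the
    statistic among the points of the orbit, with conditional size exactly
    [alpha] ([exact_test_size]).  Averaging this over the law of [X] gives the
    level under the null hypothesis ([null_size]).

    For a subgroup [S i] of [S j], the [S i] test also has conditional size
    [alpha] on every [S j] orbit, because the Haar law of [S j] is unchanged by
    multiplication by an independent uniform element of [S i]
    ([size_supergroup]).  Under the alternative the density at [x] is a function
    of the norm of [x], constant on orbits, times an increasing function of the
    statistic.  Given the orbit, the [S j] test is therefore the Neyman-Pearson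
    test, and no test of the same conditional size rejects with greater
    probability ([neyman_pearson_orbit]); integrating over the orbits gives the
    comparison of powers ([gaussian_power_le]).

    Disintegrating the normal law along the orbits requires that the Lebesgue
    measure of [R^n] be invariant under orthogonal maps.  It is represented
    here, up to a factor, by the law of [X] weighted by the inverse of the
    normal density.  This weighted measure is invariant under translations:
    the coordinates of [X] can be resampled one at a time, which reduces the
    claim to dimension one ([flat_integral_translation]).  The argument that
    proves the uniqueness of Haar measure then turns invariance under
    translations into invariance under orthogonal maps
    ([flat_integral_orthogonal]).

    The nonrandomized tests are compared by the same lemma, with [alpha]
    replaced by the level that the [S j] test attains on the orbit.  The
    [S i] test is restricted to the points where its attained level is
    not the larger one: this set is a union of [S i] orbits and has probability
    one. *)

Import Order.TTheory GRing.Theory Num.Theory.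
Import numFieldNormedType.Exports.

Set Implicit Arguments.
Unset Strict Implicit.
Unset Printing Implicit Defensive.

Local Open Scope classical_set_scope.
Local Open Scope ring_scope.

(** * Integration against a density *)

Section integral_density.
Local Open Scope ereal_scope.
Context d (T : measurableType d) (R : realType).
Variables (mu nu : {measure set T -> \bar R}) (g : T -> \bar R).
Hypotheses (mg : measurable_fun setT g) (g0 : forall x, 0 <= g x).
Hypothesis nuE : forall A, measurable A -> nu A = \int[mu]_(x in A) g x.

Import HBNNSimple.

(** Immediate for indicators, hence for simple functions; the general case
    follows by monotone convergence. *)
Lemma ge0_integral_density (f : T -> \bar R) :
  measurable_fun setT f -> (forall x, 0 <= f x) ->
  \int[nu]_x f x = \int[mu]_x (f x * g x).
Proof.
move=> mf f0; pose f_ := nnsfun_approx measurableT mf.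
have mfg n : measurable_fun setT (fun x => (f_ n x)%:E * g x).
  by apply: emeasurable_funM => //; exact/measurable_EFinP.
have f_cvg x : (f_ n x)%:E @[n --> \oo] --> f x.
  exact: (@cvg_nnsfun_approx _ _ _ _ measurableT f mf).
have f_nd x : {homo (fun n => (f_ n x)%:E) : a b / (a <= b)%N >-> a <= b}.
  by move=> a b ab; rewrite lee_fin; exact/lefP/nd_nnsfun_approx.
transitivity (limn (fun n => \int[nu]_x (f_ n x)%:E)).
  rewrite -monotone_convergence//=.
  - by apply: eq_integral => x _; apply/esym/cvg_lim.
  - by move=> n; exact/measurable_EFinP.
  - by move=> n x _; rewrite lee_fin.
transitivity (limn (fun n => \int[mu]_x ((f_ n x)%:E * g x))); last first.
  rewrite -monotone_convergence//=.
  - apply: eq_integral => x _; apply/cvg_lim => //.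
    have [->|gx0] := eqVneq (g x) 0.
      by rewrite mule0; under eq_fun do rewrite mule0; exact: cvg_cst.
    under eq_fun do rewrite muleC; rewrite (muleC (f x)).
    move: gx0 (g0 x) ; case: (g x) => [r _ _|_ _|//].
      exact: cvgeZl.
    have [fx0|fx0] := eqVneq (f x) 0.
      rewrite fx0 mule0; apply: cvg_near_cst; near=> n.
      suff -> : (f_ n x)%:E = 0 by rewrite mule0.
      apply/eqP; rewrite eq_le; apply/andP; split; last by rewrite lee_fin.
      rewrite -fx0.
      rewrite -(cvg_lim _ (f_cvg x))//; apply: lime_ge; first exact: cvgP (f_cvg x).
      by near=> k; apply: f_nd; near: k; exact: nbhs_infty_ge.
    have fx : 0 < f x by rewrite lt_def fx0 f0.
    rewrite gt0_mulye//; apply: cvg_near_cst.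
    have : \forall n \near \oo, 0 < (f_ n x)%:E.
      by have := f_cvg x _ (open_ereal_gt' fx).
    by apply: filterS => n fn0; rewrite gt0_mulye.
  - by move=> n x _; rewrite mule_ge0 ?lee_fin.
  - by move=> x _ a b ab; apply: lee_wpmul2r => //; exact: f_nd.
congr (limn _); apply/funext => n.
under eq_integral do rewrite fimfunE -fsumEFin//.
rewrite ge0_integral_fsum//; last 2 first.
  - by move=> r; exact/measurable_EFinP/measurable_funM.
  - by move=> r x _; rewrite nnfun_muleindic_ge0.
under [RHS]eq_integral.
  move=> x _; rewrite fimfunE -fsumEFin// ge0_mule_fsuml; last first.
    by move=> r; rewrite nnfun_muleindic_ge0.
  over.
rewrite [RHS]ge0_integral_fsum//; last 2 first.
  - move=> r; apply: emeasurable_funM => //.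
    exact/measurable_EFinP/measurable_funM.
  - by move=> r x _; rewrite mule_ge0// nnfun_muleindic_ge0.
apply: eq_fsbigr => r; rewrite inE => -[t _ tr].
have r0 : (0 <= r)%R by rewrite -tr.
rewrite integralZl_indic_nnsfun// integral_indic//= setIT nuE//.
under [RHS]eq_integral do rewrite EFinM -muleA.
rewrite ge0_integralZl//; last 2 first.
- by apply: emeasurable_funM => //; exact/measurable_EFinP.
- by move=> x _; rewrite mule_ge0.
congr (_ * _); rewrite integral_mkcond; apply: eq_integral => x _.
by rewrite patchE indicE; case: ifPn; rewrite ?mul1e ?mul0e.
Unshelve. all: by end_near. Qed.

End integral_density.

(** * The Borel sets of a space of matrices *)

Section borel_matrix.
Variables (R : realType) (p q : nat).
Local Notation E := (borel 'M[R]_(p, q)).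

Definition box (A : 'I_p -> 'I_q -> set R) : set 'M[R]_(p, q) :=
  [set M | forall i j, A i j (M i j)].

Definition boxes : set (set 'M[R]_(p, q)) :=
  [set box A | A in [set A | forall i j, measurable (A i j)]].

Lemma box_bigcap A : box A = \bigcap_(ij in [set: 'I_p * 'I_q])
  ((fun M : 'M[R]_(p, q) => M ij.1 ij.2) @^-1` A ij.1 ij.2).
Proof.
by apply/seteqP; split => [M AM [i j] _|M AM i j];
  [exact: AM|exact: (AM (i, j))].
Qed.

Lemma measurable_coord i j : measurable_fun [set: E] (fun M : E => M i j).
Proof.
apply: (measurability _ (RGenOpens.measurableE R)).
move=> _ [_ [a [b ->]] <-]; rewrite setTI.
apply: sub_sigma_algebra => /=.
apply: open_comp; last exact: interval_open.
by move=> M _; exact: coord_continuous.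
Qed.

Lemma ball_box (c : 'M[R]_(p, q)) (e : R) : 0 < e ->
  ball c e = box (fun i j => ball (c i j) e).
Proof. by move=> e0; apply/seteqP; split => [M []|M]. Qed.

Definition rat_ball (ck : 'M[rat]_(p, q) * nat) : set 'M[R]_(p, q) :=
  ball (map_mx ratr ck.1 : 'M[R]_(p, q)) ck.2.+1%:R^-1.

(** Balls of rational center and radius [1 / k.+1] form a countable base; this
    is what lets entrywise measurability imply Borel measurability. *)
Lemma open_bigcup_rat_ball (O : set 'M[R]_(p, q)) : open O ->
  O = \bigcup_ck [set M | rat_ball ck M /\ rat_ball ck `<=` O].
Proof.
move=> oO; apply/seteqP; split => [x Ox|x [ck _ [+ cO]]]; last exact: cO.
have /nbhs_ballP[e /= e0 eO] : nbhs x O by exact: open_nbhs_nbhs.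
have [k ke] : exists k, k.+1%:R^-1 < e / 2 :> R.
  have e20 : 0 < e / 2 by rewrite divr_gt0.
  near \oo => k; exists k; near: k.
  exact: near_infty_natSinv_lt (PosNum e20).
have k0 : 0 < k.+1%:R^-1 :> R by rewrite invr_gt0.
have rat_near i j : exists r : rat, `|ratr r - x i j| < k.+1%:R^-1.
  have /rat_in_itvoo[r] : x i j - k.+1%:R^-1 < x i j + k.+1%:R^-1
    by rewrite ltrD2l gtrN.
  by rewrite in_itv/= => rx; exists r; rewrite ltr_distl.
pose c := \matrix_(i, j) sval (cid (rat_near i j)).
have cx : ball (map_mx ratr c : 'M[R]_(p, q)) k.+1%:R^-1 x.
  rewrite ball_box// => i j; rewrite !mxE /ball/=.
  exact: (svalP (cid (rat_near i j))).
exists (c, k) => //=; split; first exact: cx.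
move=> y cy; apply: eO; apply: (@le_ball _ _ _ (k.+1%:R^-1 + k.+1%:R^-1)).
  by rewrite (splitr e) lerD// ltW.
by apply: ball_triangle cy; exact: ball_sym.
Unshelve. all: by end_near. Qed.

Lemma measurable_box A : (forall i j, measurable (A i j)) ->
  measurable (box A : set E).
Proof.
move=> mA; rewrite box_bigcap.
apply: fin_bigcap_measurable => // -[i j] _ /=.
rewrite -[X in measurable X]setTI.
by apply: measurable_coord => //; exact: mA.
Qed.

Lemma borel_mxE : @measurable _ E = <<s boxes >>.
Proof.
apply/seteqP; split => A.
  apply: smallest_sub; first exact: smallest_sigma_algebra.
  move=> O oO; rewrite (open_bigcup_rat_ball oO).
  apply: (@countable_bigcupT_measurable _ (g_sigma_algebraType boxes)).
    exact: countableP.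
  move=> ck; have [ckO|ckO] := pselect (rat_ball ck `<=` O); last first.
    rewrite [X in measurable X](_ : _ = set0); first exact: measurable0.
    by apply/seteqP; split => M //= [].
  rewrite [X in measurable X](_ : _ = rat_ball ck); last first.
    by apply/seteqP; split => M /=; [case|].
  rewrite /rat_ball ball_box ?invr_gt0//; apply: sub_sigma_algebra.
  exists (fun i j => ball ((map_mx ratr ck.1 : 'M[R]_(p, q)) i j)
    ck.2.+1%:R^-1) => // i j.
  exact: measurable_ball.
apply: smallest_sub; first exact: sigma_algebra_measurable.
by move=> _ [B mB <-]; exact: measurable_box.
Qed.

(** Measurability into the Borel sets is thereby checked one entry at a time,
    which makes matrix products jointly measurable in their two factors. *)
Lemma measurable_mx d (T : measurableType d) (f : T -> E) :
  (forall i j, measurable_fun [set: T] (fun t => f t i j)) ->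
  measurable_fun [set: T] f.
Proof.
move=> mf; apply: (measurability _ borel_mxE).
move=> _ [_ [A mA <-] <-]; rewrite setTI box_bigcap preimage_bigcap.
apply: fin_bigcap_measurable => // -[i j] _ /=.
by rewrite -[X in measurable X]setTI; apply: mf => //; exact: mA.
Qed.

Lemma boxes_setI : setI_closed boxes.
Proof.
move=> _ _ [A mA <-] [B mB <-].
exists (fun i j => A i j `&` B i j) => [i j|]; first exact: measurableI.
by apply/seteqP; split => [M ABM|M [AM BM] i j];
  [split=> i j; have [] := ABM i j|split].
Qed.

(** Boxes generate the Borel sets and are closed under intersection, so the
    pi-lambda theorem applies. *)
Lemma measure_box_unique (mu nu : {finite_measure set E -> \bar R}) :
  (forall A, (forall i j, measurable (A i j)) -> mu (box A) = nu (box A)) ->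
  forall B : set E, measurable B -> mu B = nu B.
Proof.
move=> munu B mB.
apply: (@measure_unique _ R E boxes (fun=> setT) borel_mxE boxes_setI) => //.
- by move=> _; exists (fun _ _ => setT) => //; apply/seteqP; split.
- by rewrite bigcup_const.
- by move=> _ [A mA <-]; exact: munu.
- by move=> _; rewrite ltey_eq fin_num_measure.
Qed.

End borel_matrix.

(** * Haar integrals over a compact group *)

Section measurable_mulmx.
Context d (T : measurableType d) (R : realType).

Lemma measurable_mulmx p q r (f : T -> borel 'M[R]_(p, q))
    (g : T -> borel 'M[R]_(q, r)) :
  measurable_fun [set: T] f -> measurable_fun [set: T] g ->
  measurable_fun [set: T]
    (fun t => ((f t : 'M[R]_(p, q)) *m (g t : 'M[R]_(q, r))) : borel 'M[R]_(p, r)).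
Proof.
move=> mf mg; apply: measurable_mx => i j.
under eq_fun do rewrite mxE.
apply: measurable_sum => k.
apply: measurable_funM.
  exact: (measurableT_comp (@measurable_coord R p q i k) mf).
exact: (measurableT_comp (@measurable_coord R q r k j) mg).
Qed.

Lemma measurable_stat n (iota : 'cV[R]_n) (f : T -> borel 'cV[R]_n) :
  measurable_fun [set: T] f -> measurable_fun [set: T] (fun t => stat iota (f t)).
Proof.
move=> mf; apply: (measurableT_comp (@measurable_coord R 1 1 ord0 ord0)).
by apply: measurable_mulmx => //; exact: measurable_cst.
Qed.

End measurable_mulmx.

Section group_law.
Variables (R : realType) (n : nat).
Local Notation MM := (borel 'M[R]_n).
Local Notation VV := (borel 'cV[R]_n).

Definition orbit_map (Ux : MM * VV) : VV :=
  ((Ux.1 : 'M[R]_n) *m (Ux.2 : 'cV[R]_n)).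

Lemma measurable_orbit_map : measurable_fun [set: MM * VV] orbit_map.
Proof. exact: measurable_mulmx. Qed.

(** A probability computed under [H] with [x] held fixed is measurable in [x]:
    it is the measure of a section of a set of the product space. *)
Lemma measurable_law_section (H : probability MM R) (A : set (MM * VV)) :
  measurable A -> measurable_fun [set: VV] (fun x => fine (H [set U | A (U, x)])).
Proof.
move=> mA; apply: measurableT_comp => //.
rewrite [X in measurable_fun _ X](_ : _ = H \o ysection A).
  exact: measurable_fun_ysection.
by apply/funext => x /=; congr (H _); apply/seteqP; split => U /=; rewrite /ysection/= ?inE.
Qed.

Variables (S : set 'M[R]_n) (H : probability MM R).
Hypotheses (Sgroup : compact_orthogonal_group S) (Hhaar : haar S H).

Lemma measurable_group : measurable (S : set MM).
Proof.
have [cS _ _ _ _] := Sgroup.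
rewrite -[S]setCK; apply: measurableC; apply: sub_sigma_algebra.
by rewrite /= openC; apply: compact_closed => //; exact: norm_hausdorff.
Qed.

Lemma ae_group : {ae H, forall U, S U}.
Proof.
have [HS _ _] := Hhaar; have mS := measurable_group.
exists (~` S); split => //; first exact: measurableC.
by rewrite probability_setC// HS subee.
Qed.

(** The Haar law is a law on all matrices; since it is carried by [S], only
    the values of the integrands on [S] matter. *)
Lemma haar_integral_le (f g : MM -> \bar R) :
  measurable_fun setT f -> measurable_fun setT g ->
  (forall U, (0 <= f U)%E) -> (forall U, (0 <= g U)%E) ->
  (forall U, S U -> (f U <= g U)%E) ->
  (\int[H]_U f U <= \int[H]_U g U)%E.
Proof.
move=> mf mg f0 g0 fg; apply: ae_ge0_le_integral => //.
have [N [mN N0 SN]] := ae_group; exists N; split => // U /= fgU.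
by apply: SN => SU; apply: fgU => _; exact: fg.
Qed.

Lemma haar_integral_eq (f g : MM -> \bar R) :
  measurable_fun setT f -> measurable_fun setT g ->
  (forall U, (0 <= f U)%E) -> (forall U, (0 <= g U)%E) ->
  (forall U, S U -> f U = g U) ->
  (\int[H]_U f U = \int[H]_U g U)%E.
Proof.
move=> mf mg f0 g0 fg; apply/eqP; rewrite eq_le; apply/andP; split;
  by apply: haar_integral_le => // U SU; rewrite fg.
Qed.

Lemma haar_integral_mull (V : 'M[R]_n) (f : MM -> \bar R) : S V ->
  measurable_fun setT f -> (forall U, (0 <= f U)%E) ->
  (\int[H]_U f ((V *m (U : 'M[R]_n)) : MM) = \int[H]_U f U)%E.
Proof.
move=> SV mf f0; have [_ HV _] := Hhaar.
have mV : measurable_fun setT (fun U : MM => (V *m (U : 'M[R]_n)) : MM).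
  by apply: measurable_mulmx => //; exact: measurable_cst.
rewrite -(ge0_integral_pushforward mV _ _ mf)//.
by apply: eq_measure_integral => A mA _; exact: HV.
Qed.

End group_law.

(** * The reference distribution and its critical value *)

Section reference_distribution.
Variables (R : realType) (n : nat) (H : probability (borel 'M[R]_n) R).
Variables (iota : 'cV[R]_n) (alpha : R).
Hypothesis alpha01 : 0 < alpha < 1.
Local Notation MM := (borel 'M[R]_n).
Local Notation VV := (borel 'cV[R]_n).
Local Notation ref_gt := (ref_gt H iota).
Local Notation ref_eq := (ref_eq H iota).
Local Notation crit := (critical_value H iota alpha).
Local Notation att := (attained_level H iota alpha).
Local Notation test := (exact_test H iota alpha).

Definition ref_stat (x : 'cV[R]_n) (U : MM) : R :=
  stat iota ((U : 'M[R]_n) *m x).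

Lemma measurable_ref_stat x : measurable_fun [set: MM] (ref_stat x).
Proof.
by apply: measurable_stat; apply: measurable_mulmx.
Qed.

HB.instance Definition _ x :=
  isMeasurableFun.Build _ _ _ _ (ref_stat x) (measurable_ref_stat x).

Lemma measurable_stat_orbit :
  measurable_fun [set: MM * VV] (fun Ux => stat iota (orbit_map Ux)).
Proof. by apply: measurable_stat; exact: measurable_orbit_map. Qed.

Lemma ref_gt_ccdf x c : (ref_gt x c)%:E = ccdf (ref_stat x : {RV H >-> R}) c.
Proof.
rewrite /Defs.ref_gt fineK ?fin_num_measure//.
  rewrite /ccdf /distribution /pushforward; congr (H _).
  by apply/seteqP; split => U /=; rewrite in_itv/= andbT.
rewrite -[X in measurable X]setTI -preimage_itvoy.
exact: measurable_ref_stat.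
Qed.

Lemma ref_gt_nonincreasing x : {homo ref_gt x : a b /~ a <= b}.
Proof. by move=> a b ab; rewrite -lee_fin !ref_gt_ccdf ccdf_nonincreasing. Qed.

Lemma ref_gt_le_exists x : exists c, ref_gt x c <= alpha.
Proof.
have /andP[a0 _] := alpha01.
have := @cvg_ccdfy0 _ _ _ H (ref_stat x : {RV H >-> R}).
move=> /(_ _ (@open_ereal_lt' _ 0%E alpha%:E _)).
rewrite lte_fin => /(_ a0) /= [M [_ hM]]; exists (M + 1).
by rewrite -lee_fin ref_gt_ccdf ltW// hM// ltrDl.
Qed.

Lemma ref_gt_gt_exists x : exists c, alpha < ref_gt x c.
Proof.
have /andP[_ a1] := alpha01.
have := @cvg_ccdfNy1 _ _ _ H (ref_stat x : {RV H >-> R}).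
move=> /(_ _ (@open_ereal_gt' _ 1%E alpha%:E _)).
rewrite lte_fin => /(_ a1) /= [M [_ hM]]; exists (M - 1).
by rewrite -lte_fin ref_gt_ccdf hM// gtrBl.
Qed.

Lemma has_inf_critical x : has_inf [set c | ref_gt x c <= alpha].
Proof.
split; first exact: ref_gt_le_exists.
have [b hb] := ref_gt_gt_exists x; exists b => c /= hc.
rewrite leNgt; apply/negP => cb.
have := ref_gt_nonincreasing x (ltW cb).
by rewrite leNgt (le_lt_trans hc).
Qed.

(** Rational thresholds suffice because the tail is nonincreasing; they make
    the critical value a measurable function of the observation. *)
Lemma critical_value_ltP x c :
  reflect (exists2 q : rat, ratr q < c & ref_gt x (ratr q) <= alpha) (crit x < c).
Proof.
apply: (iffP idP) => [xc|[q qc hq]].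
  have [c' hc' c'c] : exists2 c', ref_gt x c' <= alpha & c' < c.
    have [c' hc' c'c] := inf_adherent (eqbRL (subr_gt0 _ _) xc) (has_inf_critical x).
    by exists c' => //; move: c'c; rewrite addrC subrK.
  have [q] := rat_in_itvoo c'c; rewrite in_itv/= => /andP[c'q qc].
  by exists q => //; exact/(le_trans _ hc')/ref_gt_nonincreasing/ltW.
apply: le_lt_trans qc; apply: ge_inf => //.
by have [] := has_inf_critical x.
Qed.

(** The tail of a law is right continuous, so the infimum that defines the
    critical value is attained. *)
Lemma attained_level_le x : att x <= alpha.
Proof.
rewrite -lee_fin ref_gt_ccdf.
have := @ccdf_right_continuous _ _ _ H (ref_stat x : {RV H >-> R}) (crit x).
move=> /cvg_lim <- //; apply: lime_le.
  by apply/cvg_ex; eexists; exact: ccdf_right_continuous.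
near=> c; rewrite -ref_gt_ccdf lee_fin.
have /critical_value_ltP[q qc hq] : crit x < c by [].
exact/(le_trans _ hq)/ref_gt_nonincreasing/ltW.
Unshelve. all: by end_near. Qed.

Lemma attained_level_ge0 x : 0 <= att x.
Proof. by rewrite fine_ge0. Qed.

Lemma ref_gt_lt_critical x c : c < crit x -> alpha < ref_gt x c.
Proof.
move=> cx; rewrite ltNge; apply/negP => hc.
by move: cx; rewrite ltNge ge_inf//; have [] := has_inf_critical x.
Qed.

(** Any threshold below the critical value is exceeded with probability more
    than [alpha]; in the limit, the critical value is reached or exceeded with
    probability at least [alpha]. This makes the randomization probability of
    the exact test at most 1. *)
Lemma attained_level_ref_eq x : alpha <= att x + ref_eq x (crit x).
Proof.
pose c := crit x.
pose A k := [set U : MM | c - k.+1%:R^-1 < ref_stat x U].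
have mgt b : measurable [set U : MM | b < ref_stat x U].
  by rewrite -[X in measurable X]setTI -preimage_itvoy; exact: measurable_ref_stat.
have meq : measurable [set U : MM | ref_stat x U = c].
  by rewrite -[X in measurable X]setTI; apply: (measurable_ref_stat x _ (measurable_set1 c)).
have bigA : \bigcap_k A k = [set U : MM | c < ref_stat x U] `|`
                            [set U : MM | ref_stat x U = c].
  apply/seteqP; split => U /=.
    move=> AU; have : c <= ref_stat x U.
      apply/ler_addgt0Pr => e e0.
      have [k ke] : exists k, k.+1%:R^-1 < e.
        by near \oo => k; exists k; near: k; exact: near_infty_natSinv_lt (PosNum e0).
      by have := AU k I; rewrite /A/= ltrBlDr => /ltW/le_trans; apply; rewrite lerD2l ltW.
    by rewrite le_eqVlt => /orP[/eqP<-|]; [right|left].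
  move=> [cU|Uc] k _; rewrite /A/=; last by rewrite Uc gtrBl.
  by rewrite (lt_trans _ cU)// gtrBl.
have : (alpha%:E <= H (\bigcap_k A k))%E.
  have cvA : H (A k) @[k --> \oo] --> H (\bigcap_k A k).
    apply: nonincreasing_cvg_mu => //.
    - by rewrite ltey_eq fin_num_measure//; exact: mgt.
    - by move=> k; exact: mgt.
    - by apply: bigcapT_measurable => k; exact: mgt.
    - move=> a b ab; apply/subsetPset => U /=; apply: le_lt_trans.
      by rewrite lerD2l lerN2 lef_pV2// ?posrE// ler_nat.
  rewrite -(cvg_lim _ cvA)//; apply: lime_ge; first exact: cvgP cvA.
  apply: nearW => k.
  have -> : H (A k) = (ref_gt x (c - k.+1%:R^-1))%:E.
    by rewrite /Defs.ref_gt fineK// fin_num_measure//; exact: mgt.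
  by rewrite lee_fin ltW// ref_gt_lt_critical// gtrBl.
rewrite bigA measureU//; last first.
  by apply/seteqP; split => U //= [+ Uc]; rewrite Uc ltxx.
rewrite -lee_fin EFinD /attained_level /Defs.ref_gt /Defs.ref_eq.
by rewrite !fineK// fin_num_measure.
Unshelve. all: by end_near. Qed.

Lemma measurable_critical_value : measurable_fun [set: VV] crit.
Proof.
apply: (measurability _ (RGenInftyO.measurableE R)).
move=> _ [_ [c ->] <-]; rewrite setTI.
rewrite [X in measurable X](_ : _ = \bigcup_(q : rat)
    [set x : VV | ratr q < c /\ ref_gt x (ratr q) <= alpha]); last first.
  apply/seteqP; split => x /=.
    by rewrite in_itv/= => /critical_value_ltP[q qc hq]; exists q.
  by move=> [q _ [qc hq]]; rewrite in_itv/=; apply/critical_value_ltP; exists q.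
apply: bigcupT_measurable_rat => q.
have [qc|qc] := ltP (ratr q) c; last first.
  rewrite [X in measurable X](_ : _ = set0)//.
  by apply/seteqP; split => x //= [].
rewrite [X in measurable X](_ : _ =
    [set: VV] `&` (ref_gt ^~ (ratr q)) @^-1` `]-oo, alpha]); last first.
  by apply/seteqP; split => x /=; rewrite in_itv/=; [case|case].
suff : measurable_fun [set: VV] (ref_gt ^~ (ratr q)) by apply => //; exact: measurable_itv.
apply: (@measurable_law_section _ _ H [set Ux | ratr q < stat iota (orbit_map Ux)]).
rewrite -[X in measurable X]setTI -preimage_itvoy.
exact: measurable_stat_orbit.
Qed.

Lemma measurable_attained_level : measurable_fun [set: VV] att.
Proof.
apply: (@measurable_law_section _ _ H
  [set Ux | crit Ux.2 < stat iota (orbit_map Ux)]).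
rewrite -[X in measurable X]setTI; apply: measurable_fun_ltr => //.
  exact: (measurableT_comp measurable_critical_value measurable_snd).
exact: measurable_stat_orbit.
Qed.

Lemma measurable_ref_eq : measurable_fun [set: VV] (fun x => ref_eq x (crit x)).
Proof.
apply: (@measurable_law_section _ _ H
  [set Ux | stat iota (orbit_map Ux) = crit Ux.2]).
rewrite [X in measurable X](_ : _ = [set: MM * VV] `&`
    (fun Ux => stat iota (orbit_map Ux) == crit Ux.2) @^-1` [set true]); last first.
  by apply/seteqP; split => Ux /=; [move=> ->; rewrite eqxx|move=> [_ /eqP]].
apply: measurable_fun_eqr => //.
  exact: measurable_stat_orbit.
exact: (measurableT_comp measurable_critical_value measurable_snd).
Qed.

Lemma measurable_exact_test : measurable_fun [set: VV] test.
Proof.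
have mc := measurable_critical_value.
have ms : measurable_fun [set: VV] (stat iota) by exact: measurable_stat.
apply: measurable_fun_ifT; [exact: measurable_fun_ltr|exact: measurable_cst|].
apply: measurable_fun_ifT; [exact: measurable_fun_eqr| |exact: measurable_cst].
apply: measurable_funM.
  by apply: measurable_funB; [exact: measurable_cst|exact: measurable_attained_level].
under eq_fun do rewrite -powR_inv1 ?fine_ge0//.
exact: (measurableT_comp (measurable_powR (- 1)) measurable_ref_eq).
Qed.

Lemma exact_test_ge0 x : 0 <= test x.
Proof.
rewrite /exact_test; case: ifP => // _; case: ifP => // _.
rewrite divr_ge0// ?fine_ge0// subr_ge0; exact: attained_level_le.
Qed.

Lemma exact_test_le1 x : test x <= 1.
Proof.
rewrite /exact_test; case: ifP => // _; case: ifP => // _.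
have [->|e0] := eqVneq (ref_eq x (crit x)) 0; first by rewrite invr0 mulr0.
rewrite ler_pdivrMr ?lt_def ?e0 ?fine_ge0// mul1r lerBlDl.
exact: attained_level_ref_eq.
Qed.

End reference_distribution.

(** * Conditional size of the tests on an orbit *)

Section conditional_size.
Variables (R : realType) (n : nat) (S : set 'M[R]_n).
Variable H : probability (borel 'M[R]_n) R.
Hypotheses (Sgroup : compact_orthogonal_group S) (Hhaar : haar S H).
Variables (iota : 'cV[R]_n) (alpha : R).
Hypothesis alpha01 : 0 < alpha < 1.
Local Notation MM := (borel 'M[R]_n).
Local Notation VV := (borel 'cV[R]_n).
Local Notation crit := (critical_value H iota alpha).
Local Notation att := (attained_level H iota alpha).
Local Notation test := (exact_test H iota alpha).

Lemma measurable_orbit (x : 'cV[R]_n) :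
  measurable_fun [set: MM] (fun U : MM => ((U : 'M[R]_n) *m x) : VV).
Proof. by apply: measurable_mulmx. Qed.

Lemma measurable_ref_gt_set x c :
  measurable [set U : MM | c < stat iota ((U : 'M[R]_n) *m x)].
Proof.
rewrite -[X in measurable X]setTI -preimage_itvoy.
exact: (measurable_ref_stat iota x).
Qed.

Lemma measurable_ref_eq_set x c :
  measurable [set U : MM | stat iota ((U : 'M[R]_n) *m x) = c].
Proof.
rewrite -[X in measurable X]setTI.
exact: (measurable_ref_stat iota x _ (measurable_set1 c)).
Qed.

(** Moving the observation along its orbit multiplies the uniform matrix on the
    right by an element of the group, which leaves its law unchanged. *)
Lemma ref_gt_orbit V x c : S V -> ref_gt H iota (V *m x) c = ref_gt H iota x c.
Proof.
move=> SV; have [_ _ HV] := Hhaar; congr fine.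
rewrite -(HV _ _ SV (measurable_ref_gt_set x c)); congr (H _).
by apply/seteqP; split => U /=; rewrite mulmxA.
Qed.

Lemma ref_eq_orbit V x c : S V -> ref_eq H iota (V *m x) c = ref_eq H iota x c.
Proof.
move=> SV; have [_ _ HV] := Hhaar; congr fine.
rewrite -(HV _ _ SV (measurable_ref_eq_set x c)); congr (H _).
by apply/seteqP; split => U /=; rewrite mulmxA.
Qed.

Lemma critical_value_orbit V x : S V -> crit (V *m x) = crit x.
Proof.
by move=> SV; congr inf; apply/seteqP; split => c /=; rewrite ref_gt_orbit.
Qed.

Lemma attained_level_orbit V x : S V -> att (V *m x) = att x.
Proof.
by move=> SV; rewrite /attained_level critical_value_orbit// ref_gt_orbit.
Qed.

(** The randomization at the critical value supplies exactly the mass that the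
    strict rejection leaves below [alpha]. *)
Lemma exact_test_size (x : 'cV[R]_n) :
  (\int[H]_U (test ((U : 'M[R]_n) *m x))%:E = alpha%:E)%E.
Proof.
pose c := crit x; pose q := (alpha - att x) / ref_eq H iota x c.
have q0 : 0 <= q.
  by rewrite divr_ge0 ?fine_ge0// subr_ge0 attained_level_le.
pose G := [set U : MM | c < stat iota ((U : 'M[R]_n) *m x)].
pose Q := [set U : MM | stat iota ((U : 'M[R]_n) *m x) = c].
have mG : measurable G by exact: measurable_ref_gt_set.
have mQ : measurable Q by exact: measurable_ref_eq_set.
have mt : measurable_fun setT (fun U : MM => (test ((U : 'M[R]_n) *m x))%:E).
  apply/measurable_EFinP.
  exact: (measurableT_comp (measurable_exact_test H iota alpha01) (measurable_orbit x)).
have m1 : measurable_fun setT (fun U : MM => (\1_G U)%:E : \bar R).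
  exact/measurable_EFinP/measurable_indic.
have m2 : measurable_fun setT (fun U : MM => (q%:E * (\1_Q U)%:E)%E : \bar R).
  by apply: measurable_funeM; exact/measurable_EFinP/measurable_indic.
rewrite (@haar_integral_eq _ _ S H Sgroup Hhaar _
  (fun U => ((\1_G U)%:E + q%:E * (\1_Q U)%:E)%E))//.
- rewrite ge0_integralD//=; last by move=> U _; rewrite mule_ge0// lee_fin.
  rewrite ge0_integralZl//=; last exact/measurable_EFinP/measurable_indic.
  rewrite !integral_indic//= !setIT.
  have -> : H G = (att x)%:E by rewrite /attained_level /ref_gt fineK// fin_num_measure.
  have -> : H Q = (ref_eq H iota x c)%:E by rewrite /ref_eq fineK// fin_num_measure.
  rewrite -EFinM -EFinD; congr EFin.
  (* Without an atom at the critical value, [attained_level_le] and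
     [attained_level_ref_eq] squeeze the attained level to [alpha]. *)
  have [e0|e0] := eqVneq (ref_eq H iota x c) 0; last by rewrite /q divfK// subrKC.
  rewrite e0 mulr0 addr0; apply/eqP; rewrite eq_le attained_level_le//=.
  by have := attained_level_ref_eq H iota alpha01 x; rewrite -/c e0 addr0.
- by apply: emeasurable_funD.
- by move=> U; rewrite lee_fin exact_test_ge0.
- by move=> U; rewrite adde_ge0// mule_ge0// lee_fin.
- move=> U SU; rewrite -EFinM -EFinD; congr EFin.
  rewrite /exact_test critical_value_orbit// attained_level_orbit// ref_eq_orbit//.
  rewrite -/c !indicE; case: ltP => [cU|Uc].
    by rewrite mem_set// memNset ?mulr0 ?addr0//= => Uc; move: cU; rewrite /= Uc ltxx.
  rewrite memNset//=; last by apply/negP; rewrite -leNgt.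
  case: eqP => Uc'; first by rewrite mem_set//= mulr1 add0r.
  by rewrite memNset//= mulr0 addr0.
Qed.

Lemma measurable_rejection_region :
  measurable (rejection_region H iota alpha : set VV).
Proof.
rewrite -[X in measurable X]setTI; apply: measurable_fun_ltr => //.
  exact: measurable_critical_value.
exact: measurable_stat.
Qed.

Lemma rejection_size (x : 'cV[R]_n) :
  (\int[H]_U (\1_(rejection_region H iota alpha : set VV) ((U : 'M[R]_n) *m x) : R)%:E
   = (att x)%:E)%E.
Proof.
have mG := measurable_ref_gt_set x (crit x).
rewrite (@haar_integral_eq _ _ S H Sgroup Hhaar _
  (fun U => (\1_[set U : MM | crit x < stat iota ((U : 'M[R]_n) *m x)] U)%:E))//.
- by rewrite integral_indic//= setIT /attained_level /ref_gt fineK// fin_num_measure.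
- apply/measurable_EFinP.
  exact: (measurableT_comp (measurable_indic measurable_rejection_region) (measurable_orbit x)).
- exact/measurable_EFinP/measurable_indic.
- move=> U SU; congr EFin; rewrite !indicE; congr (_%:R); congr nat_of_bool.
  by apply/idP/idP => /set_mem /=; rewrite /rejection_region /= ?critical_value_orbit// => h;
     apply/mem_set => /=; rewrite ?critical_value_orbit.
Qed.

End conditional_size.

(** * Averaging over orbits and the Neyman-Pearson comparison *)

Section averaging.
Variables (R : realType) (n : nat) (S : set 'M[R]_n).
Variable H : probability (borel 'M[R]_n) R.
Hypotheses (Sgroup : compact_orthogonal_group S) (Hhaar : haar S H).
Local Notation MM := (borel 'M[R]_n).
Local Notation VV := (borel 'cV[R]_n).
Local Open Scope ereal_scope.

(** If the measure [w nu] is invariant under the group, then moving its points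
    by an independent uniform group element does not change integrals. *)
Lemma group_average (nu : probability VV R) (w f : VV -> \bar R) :
  measurable_fun setT w -> (forall x, 0 <= w x) ->
  measurable_fun setT f -> (forall x, 0 <= f x) ->
  (forall U : 'M[R]_n, S U ->
     \int[nu]_x (f ((U *m (x : 'cV[R]_n))%R : VV) * w x) =
     \int[nu]_x (f x * w x)) ->
  \int[nu]_x (f x * w x) =
  \int[nu]_x ((\int[H]_U f ((U : 'M[R]_n) *m (x : 'cV[R]_n))%R) * w x).
Proof.
move=> mw w0 mf f0 finv.
pose F (Ux : MM * VV) := f (orbit_map Ux) * w Ux.2.
have mF : measurable_fun setT F.
  apply: emeasurable_funM; first exact: (measurableT_comp mf (@measurable_orbit_map R n)).
  exact: (measurableT_comp mw measurable_snd).
have F0 Ux : 0 <= F Ux by exact: mule_ge0.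
transitivity (\int[H]_U (\int[nu]_x (f x * w x))).
  by rewrite integral_cst//= probability_setT mule1.
transitivity (\int[H]_U \int[nu]_x F (U, x)).
  apply: (haar_integral_eq Sgroup Hhaar) => [||U|U|U SU].
  - exact: measurable_cst.
  - exact: (measurable_fun_fubini_tonelli_F _ mF).
  - by apply: integral_ge0 => x _; exact: mule_ge0.
  - by apply: integral_ge0 => x _; exact: F0.
  - by rewrite -(finv _ SU).
rewrite (fubini_tonelli _ mF F0); apply: eq_integral => x _.
rewrite /F /= ge0_integralZr//.
exact: (measurableT_comp mf (measurable_orbit x)).
Qed.

(** A conditional bound on the orbits of a subgroup [S] holds on the larger
    orbits of [S']: a uniform element of [S'] keeps its law when it is
    multiplied on the left by a uniform element of [S], and the inner average
    is then taken over a single [S] orbit. *)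
Lemma size_supergroup (S' : set 'M[R]_n) (H' : probability MM R)
    (Sgroup' : compact_orthogonal_group S') (Hhaar' : haar S' H')
    (SS' : S `<=` S') (psi a : VV -> \bar R) :
  measurable_fun setT psi -> (forall x, 0 <= psi x) ->
  (forall x, 0 <= a x) ->
  (forall (V : 'M[R]_n) (x : 'cV[R]_n), S' V -> a (V *m x)%R = a x) ->
  (forall x : 'cV[R]_n, \int[H]_U psi ((U : 'M[R]_n) *m x)%R <= a x) ->
  forall x : 'cV[R]_n, \int[H']_U psi ((U : 'M[R]_n) *m x)%R <= a x.
Proof.
move=> mpsi psi0 a0 aS' psia x.
pose F (UV : MM * MM) := psi (((UV.1 : 'M[R]_n) *m ((UV.2 : 'M[R]_n) *m x))%R : VV).
have mF : measurable_fun setT F.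
  apply: (measurableT_comp mpsi); apply: measurable_mulmx => //.
  exact: measurable_mulmx.
have F0 UV : 0 <= F UV by exact: psi0.
have mpsix : measurable_fun setT (fun V : MM => psi (((V : 'M[R]_n) *m x)%R : VV)).
  exact: (measurableT_comp mpsi (measurable_orbit x)).
have -> : \int[H']_V psi ((V : 'M[R]_n) *m x)%R = \int[H]_U \int[H']_V F (U, V).
  transitivity (\int[H]_U (\int[H']_V psi ((V : 'M[R]_n) *m x)%R)).
    by rewrite integral_cst//= probability_setT mule1.
  apply: (haar_integral_eq Sgroup Hhaar) => [||U|U|U SU].
  - exact: measurable_cst.
  - exact: (measurable_fun_fubini_tonelli_F _ mF).
  - by apply: integral_ge0 => V _; exact: psi0.
  - by apply: integral_ge0 => V _; exact: F0.
  - rewrite -(haar_integral_mull Hhaar' (SS' _ SU) mpsix)//.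
    by apply: eq_integral => V _; rewrite /F/= mulmxA.
rewrite (fubini_tonelli _ mF F0).
rewrite [leRHS](_ : _ = \int[H']_V a x); last first.
  by rewrite integral_cst//= probability_setT mule1.
apply: (haar_integral_le Sgroup' Hhaar') => [||V|V|V SV].
- exact: (measurable_fun_fubini_tonelli_G _ mF).
- exact: measurable_cst.
- by apply: integral_ge0 => U _; exact: F0.
- exact: a0.
- by rewrite -(aS' _ x SV); exact: (psia (V *m x)%R).
Qed.

(** At every point of the orbit the difference [phi - psi] has the sign of
    [stat - c], hence that of [g stat - g c].  Integrating the product and using
    that [psi] has at most the size of [phi] gives the comparison; it is written
    with all terms moved to the side where they are nonnegative. *)
Lemma neyman_pearson_orbit (iota x : 'cV[R]_n) (g : R -> R) (c a : R)
    (psi phi : VV -> R) :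
  measurable_fun setT g -> (forall t, 0 <= g t)%R ->
  {homo g : s t / (s <= t)%R} ->
  measurable_fun setT psi -> measurable_fun setT phi ->
  (forall y, 0 <= psi y <= 1)%R -> (forall y, 0 <= phi y <= 1)%R ->
  (forall U, S U -> (c < stat iota (U *m x))%R -> phi (U *m x) = 1%R) ->
  (forall U, S U -> (stat iota (U *m x) < c)%R -> phi (U *m x) = 0%R) ->
  \int[H]_U (psi ((U : 'M[R]_n) *m x)%R)%:E <= a%:E ->
  \int[H]_U (phi ((U : 'M[R]_n) *m x)%R)%:E = a%:E ->
  \int[H]_U (psi ((U : 'M[R]_n) *m x)%R * g (stat iota ((U : 'M[R]_n) *m x)))%:E <=
  \int[H]_U (phi ((U : 'M[R]_n) *m x)%R * g (stat iota ((U : 'M[R]_n) *m x)))%:E.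
Proof.
move=> mg g0 gh mpsi mphi psi01 phi01 phi1 phi0 psia phia.
pose s (U : MM) := stat iota ((U : 'M[R]_n) *m x).
have mgs : measurable_fun setT (g \o s).
  exact: (measurableT_comp mg (measurable_ref_stat iota x)).
have mx (f : VV -> R) : measurable_fun setT f ->
    measurable_fun setT (fun U : MM => f (((U : 'M[R]_n) *m x)%R : VV)).
  by move=> mf; exact: (measurableT_comp mf (measurable_orbit x)).
have psi_ge0 y : (0 <= psi y)%R by have /andP[] := psi01 y.
have phi_ge0 y : (0 <= phi y)%R by have /andP[] := phi01 y.
have mfg (f : VV -> R) : measurable_fun setT f ->
    measurable_fun setT (fun U : MM => (f ((U : 'M[R]_n) *m x)%R * g (s U))%:E).
  by move=> mf; apply/measurable_EFinP; apply: measurable_funM => //; exact: mx.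
have mfc (f : VV -> R) : measurable_fun setT f ->
    measurable_fun setT (fun U : MM => (g c)%:E * (f ((U : 'M[R]_n) *m x)%R)%:E).
  by move=> mf; apply: measurable_funeM; apply/measurable_EFinP; exact: mx.
have split_int (f h : VV -> R) : (forall y, 0 <= f y)%R -> (forall y, 0 <= h y)%R ->
    measurable_fun setT f -> measurable_fun setT h ->
    \int[H]_U ((f ((U : 'M[R]_n) *m x)%R * g (s U))%:E +
               (g c)%:E * (h ((U : 'M[R]_n) *m x)%R)%:E) =
    \int[H]_U (f ((U : 'M[R]_n) *m x)%R * g (s U))%:E +
    (g c)%:E * \int[H]_U (h ((U : 'M[R]_n) *m x)%R)%:E.
  move=> f0 h0 mf mh; rewrite ge0_integralD//=.
  - rewrite ge0_integralZl//=.
    + by apply/measurable_EFinP; exact: mx.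
    + by move=> U _; rewrite lee_fin.
    + by rewrite lee_fin.
  - by move=> U _; rewrite lee_fin mulr_ge0.
  - exact: mfg.
  - by move=> U _; rewrite mule_ge0// lee_fin.
  - exact: mfc.
have : \int[H]_U (psi ((U : 'M[R]_n) *m x)%R * g (s U))%:E + (g c)%:E * a%:E <=
       \int[H]_U (phi ((U : 'M[R]_n) *m x)%R * g (s U))%:E + (g c)%:E * a%:E.
  rewrite -[in leLHS]phia -split_int//.
  apply: (@le_trans _ _ (\int[H]_U (phi ((U : 'M[R]_n) *m x)%R * g (s U))%:E +
    (g c)%:E * \int[H]_U (psi ((U : 'M[R]_n) *m x)%R)%:E)); last first.
    by apply: leeD2l; apply: lee_wpmul2l => //; rewrite lee_fin.
  rewrite -split_int//.
  apply: (haar_integral_le Sgroup Hhaar) => [||U|U|U SU].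
  - by apply: emeasurable_funD; [exact: mfg|exact: mfc].
  - by apply: emeasurable_funD; [exact: mfg|exact: mfc].
  - by rewrite adde_ge0// ?mule_ge0// lee_fin// mulr_ge0.
  - by rewrite adde_ge0// ?mule_ge0// lee_fin// mulr_ge0.
  - rewrite -!EFinM -!EFinD lee_fin.
    have /andP[p0 p1] := psi01 ((U *m x)%R : VV).
    have [sc|cs|->] := ltgtP (s U) c.
    - have := gh _ _ (ltW sc); rewrite phi0//; nra.
    - have := gh _ _ (ltW cs); rewrite phi1//; nra.
    - by rewrite addrC [leRHS]addrC !(mulrC (g c)) addrC.
by rewrite leeD2rE// -EFinM.
Qed.

End averaging.

(** * Orthogonal invariance behind the normal law *)

Section normal_translation.
Context {R : realType}.
Local Notation leb := (@lebesgue_measure R).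
Local Open Scope ereal_scope.

Lemma ge0_lebesgue_integral_translation (f : R -> \bar R) (t : R) :
  measurable_fun setT f -> (forall z, 0 <= f z) ->
  \int[leb]_z f (z + t)%R = \int[leb]_z f z.
Proof.
move=> mf f0.
have mt : measurable_fun setT ((fun z => z + t)%R : measurableTypeR R -> measurableTypeR R).
  by apply: measurable_funD => //; exact: measurable_cst.
rewrite -(ge0_integral_pushforward mt _ measurableT mf)//.
apply: eq_measure_integral => A mA _; apply/esym.
apply: (@lebesgue_measure_unique _ (pushforward leb _)) => // _ [[a b]] _ <-.
rewrite /pushforward.
rewrite [RHS](_ : _ = leb `](a - t)%R, (b - t)%R]%classic); last first.
  congr (leb _); apply/seteqP; split => z /=; rewrite !in_itv/=.
    by rewrite ltrBlDr lerBrDr.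
  by rewrite ltrBlDr lerBrDr.
rewrite !lebesgue_measure_itv/= !lte_fin ltrD2r; case: ifP => // _.
by rewrite -!EFinB opprB addrA subrK.
Qed.

(** The inverse of the normal density up to a constant: weighting the normal law
    by it gives back a multiple of the Lebesgue measure. *)
Definition gauss_weight (m s z : R) : R := expR ((z - m) ^+ 2 / (s ^+ 2 *+ 2)).

Lemma measurable_gauss_weight m s : measurable_fun setT (gauss_weight m s).
Proof.
apply: measurableT_comp => //; apply: measurable_funM => //.
by apply: measurable_funX; apply: measurable_funB.
Qed.

Lemma gauss_weight_integral (m s : R) (f : R -> \bar R) : s != 0%R ->
  measurable_fun setT f -> (forall z, 0 <= f z) ->
  \int[normal_prob m s]_z (f z * (gauss_weight m s z)%:E) =
  (normal_peak s)%:E * \int[leb]_z f z.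
Proof.
move=> s0 mf f0.
rewrite (@ge0_integral_density _ _ _ leb (normal_prob m s)
  (fun z => (normal_pdf m s z)%:E))//.
- rewrite -ge0_integralZl//=; last by rewrite lee_fin normal_peak_ge0.
  apply: eq_integral => z _; rewrite -muleA muleC; congr (_ * _).
  rewrite normal_pdfE// /normal_fun /gauss_weight -EFinM mulrCA -expRD.
  by rewrite mulNr subrr expR0 mulr1.
- by apply/measurable_EFinP; exact: measurable_normal_pdf.
- by move=> z; rewrite lee_fin normal_pdf_ge0.
- by apply: emeasurable_funM => //; apply/measurable_EFinP; exact: measurable_gauss_weight.
- by move=> z; rewrite mule_ge0// lee_fin expR_ge0.
Qed.

Lemma gauss_weight_translation (m s t : R) (f : R -> \bar R) : s != 0%R ->
  measurable_fun setT f -> (forall z, 0 <= f z) ->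
  \int[normal_prob m s]_z (f (z + t)%R * (gauss_weight m s z)%:E) =
  \int[normal_prob m s]_z (f z * (gauss_weight m s z)%:E).
Proof.
move=> s0 mf f0.
rewrite !gauss_weight_integral//.
  by rewrite ge0_lebesgue_integral_translation.
by apply: (measurableT_comp mf); exact: measurable_funD.
Qed.

End normal_translation.

Section resampling.
Variables (R : realType) (n : nat).
Local Notation VV := (borel 'cV[R]_n).
Local Notation RR := (measurableTypeR R).
Variables (nu : probability VV R) (N : 'I_n -> probability RR R).
Local Open Scope ereal_scope.

Definition set_coord (k : 'I_n) (z : R) (x : 'cV[R]_n) : 'cV[R]_n :=
  \col_i (if i == k then z else x i ord0).

Definition resample k (xz : VV * RR) : VV := set_coord k xz.2 xz.1.

Lemma measurable_resample k : measurable_fun [set: VV * RR] (resample k).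
Proof.
apply: measurable_mx => i j; rewrite /resample.
under eq_fun do rewrite mxE.
case: (i == k); first exact: measurable_snd.
exact: (measurableT_comp (@measurable_coord R n 1 i ord0) measurable_fst).
Qed.

HB.instance Definition _ k :=
  isMeasurableFun.Build _ _ _ _ (resample k) (measurable_resample k).

Hypothesis nu_box : forall A : 'I_n -> set R, (forall i, measurable (A i)) ->
  nu [set x : VV | forall i, A i ((x : 'cV[R]_n) i ord0)] = \prod_(i < n) N i (A i).

(** By independence, the law of the vector does not change when its [k]-th
    coordinate is replaced by an independent copy. *)
Lemma resample_law k (A : set VV) : measurable A ->
  nu A = distribution (nu \x N k)%E (resample k : {RV (nu \x N k)%E >-> VV}) A.
Proof.
move: A; apply: measure_box_unique => A mA.
pose B (i : 'I_n) : set R := A i ord0.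
pose B' (i : 'I_n) : set R := if i == k then setT else B i.
have mB i : measurable (B i) by exact: mA.
have mB' i : measurable (B' i) by rewrite /B'; case: ifP.
have boxE C : box (fun i (j : 'I_1) => C i) = [set x : 'cV[R]_n | forall i, C i (x i ord0)].
  by apply/seteqP; split => x Cx i; [exact: Cx|move=> j; rewrite ord1].
have -> : box A = [set x : 'cV[R]_n | forall i, B i (x i ord0)].
  by rewrite -boxE; apply/seteqP; split => x Ax i j; have := Ax i j; rewrite ord1.
transitivity ((nu \x N k) ([set x : VV | forall i, B' i ((x : 'cV[R]_n) i ord0)] `*` B k)).
  rewrite product_measure1E; [|by rewrite -boxE; apply: measurable_box|exact: mB].
  rewrite [LHS](nu_box mB) [X in _ = X * _](nu_box mB') (bigD1 k)//=.
  rewrite [in RHS](bigD1 k)//= {1}/B' eqxx probability_setT mul1e.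
  rewrite muleC; congr (_ * _); apply: eq_bigr => i ik.
  by rewrite /B' (negbTE ik).
congr ((nu \x N k) _).
apply/seteqP; split => -[x z] /=; rewrite /resample/=.
  move=> [B'x Bz] i; rewrite mxE.
  by have := B'x i; rewrite /B'; case: eqP => [->|].
move=> Bx; split; last by have := Bx k; rewrite mxE eqxx.
by move=> i; have := Bx i; rewrite mxE /B'; case: ifP.
Qed.

Lemma ge0_integral_resample k (f : VV -> \bar R) :
  measurable_fun setT f -> (forall x, 0 <= f x) ->
  \int[nu]_x f x = \int[nu]_x \int[N k]_z f (set_coord k z x).
Proof.
move=> mf f0.
rewrite (eq_measure_integral (distribution (nu \x N k)%E
  (resample k : {RV (nu \x N k)%E >-> VV}))); last first.
  by move=> A mA _; exact: resample_law.
rewrite ge0_integral_distribution//.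
rewrite fubini_tonelli1//; last by move=> xz; exact: f0.
exact: (measurableT_comp mf (measurable_resample k)).
Qed.

End resampling.

Section gaussian_invariance.
Variables (R : realType) (n : nat).
Local Notation VV := (borel 'cV[R]_n).
Variables (m : 'cV[R]_n) (s : R).
Hypothesis s0 : s != 0.

Definition sqnorm (v : 'cV[R]_n) : R := \sum_i v i ord0 ^+ 2.

(** The inverse of the normal density of mean [m], up to a constant. *)
Definition flat_weight (x : 'cV[R]_n) : R :=
  expR (sqnorm (x - m) / (s ^+ 2 *+ 2)).

Lemma sqnormE v : sqnorm v = (v^T *m v) ord0 ord0.
Proof. by rewrite mxE; apply: eq_bigr => i _; rewrite mxE expr2. Qed.

Lemma sqnormN v : sqnorm (- v) = sqnorm v.
Proof. by apply: eq_bigr => i _; rewrite mxE sqrrN. Qed.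

Lemma sqnorm_orthogonal (U : 'M[R]_n) v : U^T *m U = 1%:M ->
  sqnorm (U *m v) = sqnorm v.
Proof.
by move=> UU; rewrite !sqnormE trmx_mul mulmxA -(mulmxA v^T) UU mulmx1.
Qed.

Lemma measurable_sqnorm d (T : measurableType d) (f : T -> VV) :
  measurable_fun setT f -> measurable_fun setT (fun t => sqnorm (f t)).
Proof.
move=> mf; apply: measurable_sum => i; apply: measurable_funX.
exact: (measurableT_comp (@measurable_coord R n 1 i ord0) mf).
Qed.

Lemma measurable_addmx d (T : measurableType d) (f g : T -> VV) :
  measurable_fun setT f -> measurable_fun setT g ->
  measurable_fun setT (fun t => ((f t : 'cV[R]_n) + (g t : 'cV[R]_n)) : VV).
Proof.
move=> mf mg; apply: measurable_mx => i j.
under eq_fun do rewrite mxE.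
apply: measurable_funD.
  exact: (measurableT_comp (@measurable_coord R n 1 i j) mf).
exact: (measurableT_comp (@measurable_coord R n 1 i j) mg).
Qed.

Lemma measurable_translation (a : 'cV[R]_n) :
  measurable_fun setT (fun x : VV => ((x : 'cV[R]_n) + a) : VV).
Proof. by apply: measurable_addmx => //; exact: measurable_cst. Qed.

Lemma measurable_flat_weight : measurable_fun [set: VV] (flat_weight : VV -> R).
Proof.
apply: measurableT_comp => //; apply: measurable_funM; last exact: measurable_cst.
by apply: measurable_sqnorm; exact: measurable_translation.
Qed.

Variable nu : probability VV R.
Hypothesis nu_box : forall A : 'I_n -> set R, (forall i, measurable (A i)) ->
  nu [set x : VV | forall i, A i ((x : 'cV[R]_n) i ord0)] =
  (\prod_(i < n) normal_prob (m i ord0) s (A i))%E.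

Local Open Scope ereal_scope.

(** Up to a constant, the Lebesgue integral over [R^n], obtained from the normal
    law by cancelling its density. *)
Definition flat_integral (f : VV -> \bar R) : \bar R :=
  \int[nu]_x (f x * (flat_weight x)%:E).

Let w0 (x : VV) : 0 <= (flat_weight x)%:E.
Proof. by rewrite lee_fin expR_ge0. Qed.

Let mw : measurable_fun [set: VV] (fun x => (flat_weight x)%:E).
Proof. by apply/measurable_EFinP; exact: measurable_flat_weight. Qed.

Lemma flat_integral_ge0 f : (forall x, 0 <= f x) -> 0 <= flat_integral f.
Proof. by move=> f0; apply: integral_ge0 => x _; rewrite mule_ge0. Qed.

Lemma eq_flat_integral f g : (forall x, f x = g x) -> flat_integral f = flat_integral g.
Proof. by move=> fg; apply: eq_integral => x _; rewrite fg. Qed.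

Lemma flat_integralZl k f : 0 <= k -> measurable_fun setT f -> (forall x, 0 <= f x) ->
  flat_integral (fun x => k * f x) = k * flat_integral f.
Proof.
move=> k0 mf f0; rewrite /flat_integral -ge0_integralZl//.
- by apply: eq_integral => x _; rewrite muleA.
- exact: emeasurable_funM.
- by move=> x _; rewrite mule_ge0.
Qed.

Lemma flat_weight_set_coord k z x :
  flat_weight (set_coord k z x) = (gauss_weight (m k ord0) s z *
    expR ((\sum_(i | i != k) (x i ord0 - m i ord0) ^+ 2) / (s ^+ 2 *+ 2)))%R.
Proof.
have sE : sqnorm (set_coord k z x - m) = ((z - m k ord0) ^+ 2 +
    \sum_(i | i != k) (x i ord0 - m i ord0) ^+ 2)%R.
  rewrite /sqnorm (bigD1 k)//.
  apply: f_equal2.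
    by rewrite !mxE eqxx.
  by apply: eq_bigr => i ik; rewrite !mxE (negbTE ik).
by rewrite /flat_weight sE mulrDl expRD.
Qed.

(** Resampling the [k]-th coordinate leaves a one-dimensional integral, to which
    the translation invariance of the Lebesgue measure of the line applies. *)
Lemma flat_integral_translation1 k t f : measurable_fun setT f -> (forall x, 0 <= f x) ->
  flat_integral (fun x => f (((x : 'cV[R]_n) + t *: delta_mx k ord0)%R : VV)) = flat_integral f.
Proof.
move=> mf f0; rewrite /flat_integral.
have mft : measurable_fun setT
    (fun x : VV => f (((x : 'cV[R]_n) + t *: delta_mx k ord0)%R : VV)).
  exact: (measurableT_comp mf (measurable_translation _)).
have mfw (g : VV -> \bar R) : measurable_fun setT g ->
    measurable_fun setT (fun x => g x * (flat_weight x)%:E).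
  by move=> mg; exact: emeasurable_funM.
have fw0 (g : VV -> \bar R) : (forall x, 0 <= g x) ->
    forall x, 0 <= g x * (flat_weight x)%:E.
  by move=> g0 x; rewrite mule_ge0.
rewrite (ge0_integral_resample nu_box k (mfw _ mft) (fw0 _ (fun x => f0 _))).
rewrite (ge0_integral_resample nu_box k (mfw _ mf) (fw0 _ f0)).
apply: eq_integral => x _.
set e := (expR ((\sum_(i | i != k) (x i ord0 - m i ord0) ^+ 2) / (s ^+ 2 *+ 2)))%R.
have mfx : measurable_fun setT (fun z : R => f (set_coord k z x)).
  apply: (measurableT_comp mf).
  exact: (measurableT_comp (measurable_resample k) (measurable_pair1 x)).
have setD z : (set_coord k z x + t *: delta_mx k ord0)%R = set_coord k (z + t)%R x.
  apply/colP => i; rewrite !mxE eqxx andbT.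
  by case: eqP => _; rewrite ?mulr1 ?mulr0 ?addr0.
under eq_integral do rewrite setD flat_weight_set_coord EFinM muleA.
under [RHS]eq_integral do rewrite flat_weight_set_coord EFinM muleA.
rewrite -/e ge0_integralZr//; last 3 first.
- apply: emeasurable_funM; last by apply/measurable_EFinP; exact: measurable_gauss_weight.
  by apply: (measurableT_comp mfx); exact: measurable_funD.
- by move=> z _; rewrite mule_ge0// lee_fin expR_ge0.
- by rewrite lee_fin expR_ge0.
rewrite [RHS]ge0_integralZr//; last 3 first.
- apply: emeasurable_funM; last by apply/measurable_EFinP; exact: measurable_gauss_weight.
  exact: mfx.
- by move=> z _; rewrite mule_ge0// lee_fin expR_ge0.
- by rewrite lee_fin expR_ge0.
congr (_ * _).
exact: (gauss_weight_translation _ _ s0 mfx).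
Qed.

Lemma flat_integral_translation a f : measurable_fun setT f -> (forall x, 0 <= f x) ->
  flat_integral (fun x => f (((x : 'cV[R]_n) + a)%R : VV)) = flat_integral f.
Proof.
have -> : a = (\sum_(k <- enum 'I_n) a k ord0 *: delta_mx k ord0)%R.
  rewrite big_enum/=; apply/colP => i; rewrite summxE (bigD1 i)//=.
  rewrite big1 => [|k ki]; first by rewrite !mxE !eqxx mulr1 addr0.
  by rewrite !mxE eq_sym (negbTE ki) mulr0.
elim: (enum 'I_n) f => [|k r IH] f mf f0.
  by rewrite big_nil; apply: eq_flat_integral => x; rewrite addr0.
rewrite big_cons -[RHS](flat_integral_translation1 k (a k ord0) mf f0).
rewrite -[RHS]IH//.
- by apply: eq_flat_integral => x; congr (f _); rewrite addrA addrAC.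
- exact: (measurableT_comp mf (measurable_translation _)).
Qed.

Lemma flat_integral_swap (F : VV * VV -> \bar R) :
  measurable_fun setT F -> (forall xy, 0 <= F xy) ->
  flat_integral (fun x => flat_integral (fun y => F (x, y))) =
  flat_integral (fun y => flat_integral (fun x => F (x, y))).
Proof.
move=> mF F0.
pose G xy := F xy * (flat_weight xy.2)%:E * (flat_weight xy.1)%:E.
have mG : measurable_fun setT G.
  apply: emeasurable_funM; last exact: (measurableT_comp mw measurable_fst).
  by apply: emeasurable_funM => //; exact: (measurableT_comp mw measurable_snd).
have G0 xy : 0 <= G xy by rewrite !mule_ge0.
transitivity (\int[nu]_x \int[nu]_y G (x, y)).
  apply: eq_integral => x _; rewrite -ge0_integralZr//.
  - apply: emeasurable_funM => //.
    exact: (measurableT_comp mF (measurable_pair1 x)).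
  - by move=> y _; rewrite mule_ge0.
rewrite (fubini_tonelli _ mG G0); apply: eq_integral => y _.
transitivity (\int[nu]_x (F (x, y) * (flat_weight x)%:E * (flat_weight y)%:E)).
  by apply: eq_integral => x _; rewrite /G/= muleAC.
rewrite ge0_integralZr//.
- apply: emeasurable_funM => //.
  exact: (measurableT_comp mF (measurable_pair2 y)).
- by move=> x _; rewrite mule_ge0.
Qed.

(* A radial function whose flat integral is known and finite, so that it can be
   inserted as a factor 1 in the proof of orthogonal invariance. *)
Let h (x : VV) : \bar R := (expR (- (sqnorm x / (s ^+ 2 *+ 2))))%:E.

Let h0 x : 0 <= h x. Proof. by rewrite lee_fin expR_ge0. Qed.

Let mh : measurable_fun setT h.
Proof.
apply/measurable_EFinP; apply: measurableT_comp => //; apply: measurableT_comp => //.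
by apply: measurable_funM; [exact: measurable_sqnorm|exact: measurable_cst].
Qed.

Let flat_integral_h : flat_integral h = 1.
Proof.
(* After translation by the mean, [h] is the inverse of the weight. *)
rewrite -(flat_integral_translation (- m)%R)//.
transitivity (\int[nu]_x (1 : \bar R)).
  apply: eq_integral => x _; rewrite -EFinM /flat_weight -expRD.
  by rewrite addrC subrr expR0.
by rewrite integral_cst//= probability_setT mule1.
Qed.

(** Read from the bottom up, with both variables integrated against the flat
    measure: [f x * h (U y)] becomes [f (x + U y) * h (U y)] by translating [x],
    then [f (U y) * h (U y - x)] by translating [y]; integrating out the factor
    with [h] at both ends, which gives 1 because [h] is radial, leaves [f] on
    one side and [f] composed with [U] on the other. *)
Lemma flat_integral_orthogonal (U : 'M[R]_n) f : U^T *m U = 1%:M ->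
  measurable_fun setT f -> (forall x, 0 <= f x) ->
  flat_integral (fun x => f ((U *m (x : 'cV[R]_n))%R : VV)) = flat_integral f.
Proof.
move=> UU mf f0; have UU' : U *m U^T = 1%:M by exact: mulmx1C.
have mU d (T : measurableType d) (g : T -> VV) : measurable_fun setT g ->
    measurable_fun setT (fun t => (U *m (g t : 'cV[R]_n)) : VV).
  by move=> mg; apply: measurable_mulmx => //; exact: measurable_cst.
have mN : measurable_fun setT (fun x : VV => (- (x : 'cV[R]_n))%R : VV).
  apply: measurable_mx => i j; under eq_fun do rewrite mxE.
  by apply: measurableT_comp => //; exact: measurable_coord.
pose F (xy : VV * VV) := f (((xy.1 : 'cV[R]_n) + U *m (xy.2 : 'cV[R]_n))%R : VV) *
  h ((U *m (xy.2 : 'cV[R]_n))%R : VV).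
pose G (xy : VV * VV) := f ((U *m (xy.2 : 'cV[R]_n))%R : VV) *
  h ((U *m (xy.2 : 'cV[R]_n) - (xy.1 : 'cV[R]_n))%R : VV).
have mUy := mU _ _ _ (@measurable_snd _ _ VV VV).
have mF : measurable_fun setT F.
  apply: emeasurable_funM; last exact: (measurableT_comp mh mUy).
  by apply: (measurableT_comp mf); exact: measurable_addmx.
have mG : measurable_fun setT G.
  apply: emeasurable_funM; first exact: (measurableT_comp mf mUy).
  apply: (measurableT_comp mh); apply: measurable_addmx => //.
  exact: (measurableT_comp mN measurable_fst).
transitivity (flat_integral (fun y => flat_integral (fun x => G (x, y)))).
  apply: eq_flat_integral => y; rewrite /G/= flat_integralZl//.
    have -> : flat_integral (fun x => h ((U *m (y : 'cV[R]_n) - (x : 'cV[R]_n))%R : VV)) =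
              flat_integral (fun x => h (((x : 'cV[R]_n) + - (U *m (y : 'cV[R]_n)))%R : VV)).
      by apply: eq_flat_integral => x; rewrite /h -sqnormN opprB.
    by rewrite flat_integral_translation// flat_integral_h mule1.
  apply: (measurableT_comp mh); apply: measurable_addmx => //; exact: measurable_cst.
rewrite -flat_integral_swap//; last by move=> xy; rewrite mule_ge0.
transitivity (flat_integral (fun x => flat_integral (fun y => F (x, y)))).
  apply: eq_flat_integral => x.
  rewrite -(@flat_integral_translation (- (U^T *m (x : 'cV[R]_n)))%R (fun y => F (x, y))).
  - apply: eq_flat_integral => y; rewrite /F /G /= mulmxDr mulmxN mulmxA UU' mul1mx.
    by rewrite subrKC.
  - exact: (measurableT_comp mF (measurable_pair1 x)).
  - by move=> y; rewrite mule_ge0.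
rewrite flat_integral_swap//; last by move=> xy; rewrite mule_ge0.
transitivity (flat_integral (fun y => flat_integral f * h y)).
  apply: eq_flat_integral => y; rewrite /F/=.
  rewrite -[X in flat_integral X](_ : (fun x => h ((U *m (y : 'cV[R]_n))%R : VV) *
    f (((x : 'cV[R]_n) + U *m (y : 'cV[R]_n))%R : VV)) = _); last first.
    by apply/funext => x; rewrite muleC.
  rewrite flat_integralZl//; last exact: (measurableT_comp mf (measurable_translation _)).
  by rewrite flat_integral_translation// muleC /h sqnorm_orthogonal.
by rewrite flat_integralZl// ?flat_integral_h ?mule1//; exact: flat_integral_ge0.
Qed.

End gaussian_invariance.

(** * Comparison of powers under the normal alternative *)

Section gaussian_power.
Variables (R : realType) (n : nat) (S : set 'M[R]_n).
Variable H : probability (borel 'M[R]_n) R.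
Hypotheses (Sgroup : compact_orthogonal_group S) (Hhaar : haar S H).
Variables (iota : 'cV[R]_n) (mu s : R).
Hypotheses (mu0 : 0 < mu) (s0 : 0 < s).
Local Notation MM := (borel 'M[R]_n).
Local Notation VV := (borel 'cV[R]_n).
Local Notation m := (mu *: iota).
Variable nu : probability VV R.
Hypothesis nu_box : forall A : 'I_n -> set R, (forall i, measurable (A i)) ->
  nu [set x : VV | forall i, A i ((x : 'cV[R]_n) i ord0)] =
  (\prod_(i < n) normal_prob (m i ord0) s (A i))%E.

Let density (x : VV) : R := expR (- (sqnorm ((x : 'cV[R]_n) - m) / (s ^+ 2 *+ 2))).

(* Up to a constant, the normal density factors as [radial x * slope (stat x)]
   since the squared norm of [x - mu iota] is a radial term minus a multiple of
   the statistic. *)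
Let radial (x : 'cV[R]_n) : R := expR (- ((sqnorm x + sqnorm m) / (s ^+ 2 *+ 2))).

Let slope (t : R) : R := expR (mu * t / s ^+ 2).

Let measurable_density : measurable_fun setT density.
Proof.
apply: measurableT_comp => //; apply: measurableT_comp => //.
apply: measurable_funM; last exact: measurable_cst.
by apply: measurable_sqnorm; exact: measurable_translation.
Qed.

Let measurable_slope : measurable_fun setT slope.
Proof.
apply: measurableT_comp => //; apply: measurable_funM; last exact: measurable_cst.
by apply: measurable_funM => //; exact: measurable_cst.
Qed.

Let slope_homo : {homo slope : a b / a <= b}.
Proof.
move=> a b ab; rewrite ler_expR ler_wpM2r ?invr_ge0 ?sqr_ge0//.
by rewrite ler_wpM2l// ltW.
Qed.

Let sqnorm_shift (y : 'cV[R]_n) :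
  sqnorm (y - m) = sqnorm y + sqnorm m - (mu * stat iota y) *+ 2.
Proof.
rewrite /sqnorm /stat mxE mulr_sumr -sumrMnl -sumrN -!big_split/=.
apply: eq_bigr => i _; rewrite !mxE; ring.
Qed.

Let density_orbit U (x : 'cV[R]_n) : S U ->
  density (U *m x) = radial x * slope (stat iota (U *m x)).
Proof.
move=> SU; have [_ SO _ _ _] := Sgroup.
rewrite /density /radial /slope -expRD sqnorm_shift sqnorm_orthogonal; last exact: SO.
congr expR; have ss : s != 0 by rewrite gt_eqF.
by field.
Qed.

Local Open Scope ereal_scope.

Let flat_integral_density (f : VV -> R) :
  \int[nu]_x (f x)%:E = flat_integral m s nu (fun x => (f x * density x)%:E).
Proof.
apply: eq_integral => x _; rewrite -EFinM -mulrA /density /flat_weight -expRD.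
by rewrite addNr expR0 mulr1.
Qed.

(** The power is the flat integral of the test times the normal density; its
    orbit averages are compared pointwise, the radial factor of the density
    being constant on each orbit. *)
Lemma gaussian_power_le (psi phi : VV -> R) (c a : 'cV[R]_n -> R) :
  measurable_fun setT psi -> measurable_fun setT phi ->
  (forall y, 0 <= psi y <= 1)%R -> (forall y, 0 <= phi y <= 1)%R ->
  (forall x U, S U -> (c x < stat iota (U *m x))%R -> phi (U *m x) = 1%R) ->
  (forall x U, S U -> (stat iota (U *m x) < c x)%R -> phi (U *m x) = 0%R) ->
  (forall x : 'cV[R]_n, \int[H]_U (psi ((U : 'M[R]_n) *m x)%R)%:E <= (a x)%:E) ->
  (forall x : 'cV[R]_n, \int[H]_U (phi ((U : 'M[R]_n) *m x)%R)%:E = (a x)%:E) ->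
  \int[nu]_x (psi x)%:E <= \int[nu]_x (phi x)%:E.
Proof.
move=> mpsi mphi psi01 phi01 phi1 phi0 psia phia.
have sN0 : s != 0%R by rewrite gt_eqF.
have [_ SO _ _ _] := Sgroup.
have psi_ge0 y : (0 <= psi y)%R by have /andP[] := psi01 y.
have phi_ge0 y : (0 <= phi y)%R by have /andP[] := phi01 y.
have mfd (f : VV -> R) : measurable_fun setT f ->
    measurable_fun setT (fun x => (f x * density x)%:E : \bar R).
  by move=> mf; apply/measurable_EFinP; apply: measurable_funM.
have fd0 (f : VV -> R) : (forall y, 0 <= f y)%R ->
    forall x, 0 <= (f x * density x)%:E.
  by move=> f0 x; rewrite lee_fin mulr_ge0// expR_ge0.
have mw : measurable_fun [set: VV] (fun x => (flat_weight m s x)%:E).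
  by apply/measurable_EFinP; exact: measurable_flat_weight.
have w0 (x : VV) : 0 <= (flat_weight m s x)%:E by rewrite lee_fin expR_ge0.
have mOrb (f : VV -> R) x : measurable_fun setT f -> measurable_fun setT
    (fun U : MM => (f ((U : 'M[R]_n) *m x)%R * density ((U : 'M[R]_n) *m x)%R)%:E).
  by move=> mf; exact: (measurableT_comp (mfd _ mf) (measurable_orbit x)).
have average (f : VV -> R) : measurable_fun setT f -> (forall y, 0 <= f y)%R ->
    \int[nu]_x (f x)%:E = \int[nu]_x ((\int[H]_U
      (f ((U : 'M[R]_n) *m (x : 'cV[R]_n))%R *
       density ((U : 'M[R]_n) *m (x : 'cV[R]_n))%R)%:E) * (flat_weight m s x)%:E).
  move=> mf f0; rewrite flat_integral_density.
  apply: (group_average Sgroup Hhaar mw w0 (mfd _ mf) (fd0 _ f0)) => U SU.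
  exact: (flat_integral_orthogonal sN0 nu_box (SO _ SU) (mfd _ mf) (fd0 _ f0)).
have mAvg (f : VV -> R) : measurable_fun setT f -> (forall y, 0 <= f y)%R ->
    measurable_fun [set: VV] (fun x : VV => (\int[H]_U
      (f ((U : 'M[R]_n) *m (x : 'cV[R]_n))%R *
       density ((U : 'M[R]_n) *m (x : 'cV[R]_n))%R)%:E) * (flat_weight m s x)%:E).
  move=> mf f0; apply: emeasurable_funM => //.
  pose F (Ux : MM * VV) := (f (orbit_map Ux) * density (orbit_map Ux))%:E.
  have mF : measurable_fun setT F.
    exact: (measurableT_comp (mfd _ mf) (@measurable_orbit_map R n)).
  have F0 Ux : 0 <= F Ux by exact: (fd0 _ f0).
  exact: (measurable_fun_fubini_tonelli_G _ mF F0).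
rewrite (average _ mpsi psi_ge0) (average _ mphi phi_ge0).
apply: ge0_le_integral => //.
- move=> x _; rewrite mule_ge0//; apply: integral_ge0 => U _; exact: (fd0 _ psi_ge0).
- exact: mAvg.
- exact: mAvg.
move=> x _; apply: lee_wpmul2r => //.
have orbitE (f : VV -> R) : measurable_fun setT f -> (forall y, 0 <= f y)%R ->
    \int[H]_U (f ((U : 'M[R]_n) *m (x : 'cV[R]_n))%R *
      density ((U : 'M[R]_n) *m (x : 'cV[R]_n))%R)%:E =
    (radial x)%:E * \int[H]_U (f ((U : 'M[R]_n) *m (x : 'cV[R]_n))%R *
      slope (stat iota ((U : 'M[R]_n) *m (x : 'cV[R]_n))%R))%:E.
  move=> mf f0.
  have mfs : measurable_fun setT (fun U : MM =>
      (f ((U : 'M[R]_n) *m (x : 'cV[R]_n))%R *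
      slope (stat iota ((U : 'M[R]_n) *m (x : 'cV[R]_n))%R))%:E).
    apply/measurable_EFinP; apply: measurable_funM.
      exact: (measurableT_comp mf (measurable_orbit x)).
    exact: (measurableT_comp measurable_slope (measurable_ref_stat iota x)).
  rewrite -ge0_integralZl//; last 2 first.
  - by move=> U _; rewrite lee_fin mulr_ge0// expR_ge0.
  - by rewrite lee_fin expR_ge0.
  apply: (haar_integral_eq Sgroup Hhaar) => [||U|U|U SU].
  - exact: mOrb.
  - exact: measurable_funeM.
  - exact: (fd0 _ f0).
  - by rewrite mule_ge0// lee_fin ?mulr_ge0// expR_ge0.
  - by rewrite density_orbit// -EFinM mulrCA.
rewrite !orbitE//; apply: lee_wpmul2l; first by rewrite lee_fin expR_ge0.
apply: (neyman_pearson_orbit Sgroup Hhaar (c := c x) (a := a x)) => //.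
- by move=> t; exact: expR_ge0.
- exact: phi1.
- exact: phi0.
Qed.

End gaussian_power.

(** * The tests applied to an observation *)

Section observation.
Context d (T : measurableType d) (R : realType) (n : nat).
Variables (P : probability T R) (X : {RV P >-> borel 'cV[R]_n}).
Local Notation VV := (borel 'cV[R]_n).
Local Open Scope ereal_scope.

Lemma expectation_law (f : VV -> R) : measurable_fun setT f ->
  (forall x, 0 <= f x)%R ->
  'E_P[f \o X] = \int[distribution P X]_x (f x)%:E.
Proof.
move=> mf f0; rewrite unlock ge0_integral_distribution//.
exact/measurable_EFinP.
Qed.

Lemma probability_law (A : set VV) : measurable A ->
  P [set w | A (X w)] = \int[distribution P X]_x (\1_A x : R)%:E.
Proof. by move=> mA; rewrite integral_indic// setIT. Qed.

(** The law of [X] is invariant under the group, so the expectation of a test is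
    the mean of its averages over the orbits. *)
Lemma null_size (S : set 'M[R]_n) (H : probability (borel 'M[R]_n) R)
    (phi : VV -> R) (a : R) :
  compact_orthogonal_group S -> haar S H -> invariant_under S X ->
  measurable_fun setT phi -> (forall x, 0 <= phi x)%R ->
  (forall x : 'cV[R]_n, \int[H]_U (phi ((U : 'M[R]_n) *m x)%R)%:E = a%:E) ->
  'E_P[phi \o X] = a%:E.
Proof.
move=> Sgroup Hhaar inv mphi phi0 phia.
pose nu := distribution P X.
have mphi' : measurable_fun setT (fun x : VV => (phi x)%:E) by exact/measurable_EFinP.
rewrite expectation_law//.
transitivity (\int[nu]_x ((phi x)%:E * 1)).
  by apply: eq_integral => x _; rewrite mule1.
rewrite (group_average Sgroup Hhaar (w := fun=> 1))//.
  transitivity (\int[nu]_x (cst a%:E x)).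
    by apply: eq_integral => x _; rewrite phia mule1.
  by rewrite integral_cst// [X in _ * X]probability_setT mule1.
move=> U SU.
have mU : measurable_fun setT (fun x : VV => ((U *m (x : 'cV[R]_n))%R : VV)).
  by apply: measurable_mulmx => //; exact: measurable_cst.
under eq_integral do rewrite mule1.
under [RHS]eq_integral do rewrite mule1.
rewrite -(ge0_integral_pushforward mU _ measurableT mphi'); last first.
  by move=> x _; rewrite lee_fin.
by apply: eq_measure_integral => A mA _; apply/esym; exact: inv.
Qed.

End observation.

Lemma nested_subset (T : Type) (S : nat -> set T) :
  (forall k, S k `<=` S k.+1) -> forall i j, (i <= j)%N -> S i `<=` S j.
Proof.
move=> SS i j /subnK <-; elim: (j - i)%N => [|k IH] //.
by rewrite addSn; exact: subset_trans (SS _).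
Qed.

Lemma rejection_le_exact_test (R : realType) (n : nat) (H : probability (borel 'M[R]_n) R)
    (iota x : 'cV[R]_n) (alpha : R) : 0 < alpha < 1 ->
  \1_(rejection_region H iota alpha) x <= exact_test H iota alpha x.
Proof.
move=> alpha01; rewrite indicE.
case: (boolP (x \in _)) => [/set_mem xr|_]; last exact: exact_test_ge0.
by rewrite /exact_test ifT.
Qed.

Theorem theorem2 (R : realType) (n : nat) (S : nat -> set 'M[R]_n)
    (H : nat -> probability (borel 'M[R]_n) R)
    (iota : 'cV[R]_n) (alpha : R)
    (Sgroup : forall k, compact_orthogonal_group (S k))
    (Snested : forall k, S k `<=` S k.+1)
    (Hhaar : forall k, haar (S k) (H k))
    (iota_unit : iota^T *m iota = 1%:M)
    (alpha01 : 0 < alpha < 1)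
    (i j k : nat) (ijk : (i <= j <= k)%N)
    (d : measure_display) (T : measurableType d) (P : probability T R)
    (X : {RV P >-> borel 'cV[R]_n}) :
  (* under the null hypothesis both tests have level alpha *)
  (invariant_under (S k) X ->
     [/\ ('E_P[exact_test (H i) iota alpha \o X] = alpha%:E)%E,
         ('E_P[exact_test (H j) iota alpha \o X] = alpha%:E)%E,
         (P [set w | rejection_region (H i) iota alpha (X w)] <= alpha%:E)%E &
         (P [set w | rejection_region (H j) iota alpha (X w)] <= alpha%:E)%E])
  /\
  (* under the alternative the S_j test is at least as powerful *)
  (forall mu sigma : R, 0 < mu -> 0 < sigma ->
     normal_vector (mu *: iota) sigma X ->
     ('E_P[exact_test (H i) iota alpha \o X] <=
        'E_P[exact_test (H j) iota alpha \o X])%E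
     /\
     ({ae P, forall w, attained_level (H i) iota alpha (X w) <=
                       attained_level (H j) iota alpha (X w)} ->
      (P [set w | rejection_region (H i) iota alpha (X w)] <=
         P [set w | rejection_region (H j) iota alpha (X w)])%E)).
Proof.
have [ij jk] := andP ijk.
have Sij := nested_subset Snested ij; have Sjk := nested_subset Snested jk.
have mtest l := measurable_exact_test (H l) iota alpha01.
have test_ge0 l := exact_test_ge0 (H l) iota alpha01.
have test01 l x : 0 <= exact_test (H l) iota alpha x <= 1.
  by rewrite test_ge0 exact_test_le1.
have mrej l := measurable_rejection_region (H l) iota alpha01.
have testsize l := exact_test_size (Sgroup l) (Hhaar l) iota alpha01.
split.
  move=> invX.
  have inv l : S l `<=` S k -> invariant_under (S l) X.
    by move=> Slk U SU; exact/invX/Slk.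
  have size l : S l `<=` S k -> ('E_P[exact_test (H l) iota alpha \o X] = alpha%:E)%E.
    move=> /inv invl.
    exact: (null_size (Sgroup l) (Hhaar l) invl (mtest l) (test_ge0 l) (testsize l)).
  have rej_size l : S l `<=` S k ->
      (P [set w | rejection_region (H l) iota alpha (X w)] <= alpha%:E)%E.
    move=> /size <-; rewrite probability_law// expectation_law//.
    apply: ge0_le_integral => //.
    - exact/measurable_EFinP/measurable_indic.
    - exact/measurable_EFinP.
    - by move=> x _; rewrite lee_fin; exact: rejection_le_exact_test.
  have Sik := subset_trans Sij Sjk.
  by split; [exact: size|exact: size|exact: rej_size|exact: rej_size].
move=> mu sigma mu0 sigma0 normalX.
pose nu := distribution P X.
have nu_box : forall A : 'I_n -> set R, (forall i, measurable (A i)) ->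
    nu [set x : borel 'cV[R]_n | forall i, A i ((x : 'cV[R]_n) i ord0)] =
    (\prod_(i < n) normal_prob ((mu *: iota) i ord0) sigma (A i))%E.
  exact: normalX.
have power := gaussian_power_le (Sgroup j) (Hhaar j) mu0 sigma0 nu_box.
split.
  rewrite (expectation_law X (mtest i) (test_ge0 i)).
  rewrite (expectation_law X (mtest j) (test_ge0 j)).
  apply: (power _ _ (critical_value (H j) iota alpha) (fun=> alpha)) => //.
  - move=> x U SU cx.
    by rewrite /exact_test (critical_value_orbit (Hhaar j)) // cx.
  - move=> x U SU cx; rewrite /exact_test (critical_value_orbit (Hhaar j)) //.
    by rewrite ltNge (ltW cx)/= lt_eqF.
  - apply: (size_supergroup (Sgroup i) (Hhaar i) (Sgroup j) (Hhaar j) Sij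
      (psi := fun x => (exact_test (H i) iota alpha x)%:E)
      (a := fun=> alpha%:E)) => //.
    + exact/measurable_EFinP.
    + by move=> x; rewrite lee_fin.
    + by move=> _; rewrite lee_fin ltW//; case/andP: alpha01.
    + by move=> x; rewrite testsize.
move=> att_le.
pose att l := attained_level (H l) iota alpha : borel 'cV[R]_n -> R.
have matt l : measurable_fun setT (att l) by exact: measurable_attained_level.
pose G : set (borel 'cV[R]_n) := [set x | att i x <= att j x].
have mG : measurable G.
  by rewrite -[X in measurable X]setTI; exact: measurable_fun_ler.
pose rej l := rejection_region (H l) iota alpha : set (borel 'cV[R]_n).
have mrejG : measurable (rej i `&` G) by apply: measurableI => //; exact: mrej.
(* [G] has full probability and is a union of orbits of [S i], so intersecting
   with it changes neither the rejection probability nor the structure of the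
   [S i] test on its orbits. *)
apply: (@le_trans _ _ (P [set w | (rej i `&` G) (X w)])).
  have mX (A : set (borel 'cV[R]_n)) : measurable A -> measurable [set w | A (X w)].
    by move=> mA; rewrite -[X in measurable X]setTI; exact: measurable_funP.
  have [N [mN N0 GN]] := att_le.
  rewrite (@le_trans _ _ (P ([set w | (rej i `&` G) (X w)] `|` N)))//.
    apply: le_measure; rewrite ?inE; 
      [by apply: mX; exact: mrej|by apply: measurableU => //; exact: mX|].
    move=> w rw; have [Gw|Gw] := pselect (G (X w)); first by left.
    by right; apply: GN => /=; exact: Gw.
  apply: le_trans (measureU2 _ _ _) _ => //; first exact: mX.
  by rewrite [X in (_ + X)%E]N0 adde0.
rewrite !probability_law//.
have indic01 (B : set (borel 'cV[R]_n)) x : 0 <= (\1_B x : R) <= 1.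
  by rewrite indicE; case: (x \in B); rewrite ?ler01 ?lexx.
apply: (power _ _ (critical_value (H j) iota alpha) (att j)) => //.
- move=> x U SU cx; rewrite indicE mem_set//.
  by rewrite /rejection_region/= (critical_value_orbit (Hhaar j)).
- move=> x U SU cx; rewrite indicE memNset//.
  rewrite /rejection_region/= (critical_value_orbit (Hhaar j))//.
  by apply/negP; rewrite -leNgt ltW.
- apply: (size_supergroup (Sgroup i) (Hhaar i) (Sgroup j) (Hhaar j) Sij
    (psi := fun x => (\1_(rej i `&` G) x)%:E) (a := fun x => (att j x)%:E)).
  + exact/measurable_EFinP/measurable_indic.
  + by move=> x; rewrite lee_fin.
  + by move=> x; rewrite lee_fin; exact: attained_level_ge0.
  + by move=> V x SV; rewrite /att (attained_level_orbit (Hhaar j)).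
  + move=> x.
    have GU (U : 'M[R]_n) : S i U -> G (U *m x) = G x.
      move=> SU; rewrite /G /= /att (attained_level_orbit (Hhaar i))//.
      by rewrite (attained_level_orbit (Hhaar j))//; exact: Sij.
    have mo B : measurable B -> measurable_fun setT
        (fun U : borel 'M[R]_n => (\1_B (((U : 'M[R]_n) *m x) : borel 'cV[R]_n) : R)%:E).
      move=> mB; apply/measurable_EFinP.
      exact: (measurableT_comp (measurable_indic mB) (measurable_orbit x)).
    have [Gx|Gx] := pselect (G x).
      apply: (@le_trans _ _ (att i x)%:E); last by rewrite lee_fin.
      rewrite -(rejection_size (Sgroup i) (Hhaar i) iota alpha01).
      apply: (haar_integral_le (Sgroup i) (Hhaar i)) => [||U|U|U SU].
      * exact: mo.
      * by apply: mo; exact: mrej.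
      * by rewrite lee_fin.
      * by rewrite lee_fin.
      * rewrite lee_fin !indicE; case: (boolP (_ \in rej i `&` G)).
          by move=> /set_mem[rU _]; rewrite mem_set.
        by rewrite ler0n.
    apply: (@le_trans _ _ (\int[H i]_U 0)%E).
      apply: (haar_integral_le (Sgroup i) (Hhaar i)) => [||U|U|U SU] //.
      * exact: mo.
      * by rewrite indicE memNset// => -[_]; rewrite GU.
    by rewrite integral0 lee_fin; exact: attained_level_ge0.
- exact: (rejection_size (Sgroup j) (Hhaar j) iota alpha01).
Qed.
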